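(* There exist absolute constants $C_0>0$ and $C_1>0$ such that the following holds for every integer $d\ge 6$ and every $\sigma>0$. If an estimator $\widehat T$ satisfies $$\sup_{\theta\in\Theta_s}\mathbf{E}_\theta\big[(\widehat T-L(\theta))^2\big]\le C_0\,\sigma^2s^2\log\Big(1+\frac{d\log d}{s^2}\Big)\quad\text{for some } s\in\{1,\dots,d\}\text{ with } s\ge d^{1/4},$$ then $$\sup_{\theta\in\Theta_1}\mathbf{E}_\theta\big[(\widehat T-L(\theta))^2\big]\ge C_1\sigma^2d^{1/4}.$$
   Context: Model: one observes $y=(y_1,\dots,y_d)$ with $y_j=\theta_j+\sigma\xi_j$, $j=1,\dots,d$, where $\theta\in\mathbb{R}^d$ is unknown, $\xi_j$ are i.i.d. standard normal and $\sigma>0$; $\mathbf{E}_\theta$ is the expectation under the law of $y$. $L(\theta)=\sum_{i=1}^d\theta_i$. $\Theta_s=\{\theta\in\mathbb{R}^d:\|\theta\|_0\le s\}$, where $\|\theta\|_0$ is the number of nonzero components of $\theta$. An estimator is a real-valued measurable function of $y$. $\log$ is the natural logarithm. *)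

(* Defs.v *)
From HB Require Import structures.
From mathcomp Require Import all_boot all_order all_algebra.
From mathcomp Require Import all_classical all_reals all_analysis.

Set Implicit Arguments.
Unset Strict Implicit.
Unset Printing Implicit Defensive.

Import Order.TTheory GRing.Theory Num.Theory.
Import numFieldNormedType.Exports.

Local Open Scope classical_set_scope.
Local Open Scope ring_scope.

Section independence.
Context {disp : measure_display} {Omega : measurableType disp} {R : realType}.

Definition mutually_independent (P : probability Omega R) (I : finType)
    (X : I -> {RV P >-> R}) : Prop :=
  forall (J : {set I}) (B : I -> set R),
    (forall i, i \in J -> measurable (B i)) ->
    P (\bigcap_(i in [set` J]) (X i @^-1` B i)) =
    (\prod_(i in J) P (X i @^-1` B i))%E.

(* The laws are compared on measurable sets only: [distribution] and
   [normal_prob] are set functions with meaningless values elsewhere. *)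
Definition iid_standard_normal (P : probability Omega R) (d : nat)
    (xi : 'I_d -> {RV P >-> R}) : Prop :=
  (forall (j : 'I_d) (A : set R), measurable A ->
     distribution P (xi j) A = normal_prob 0 1 A) /\
  mutually_independent xi.

End independence.

(* Points of R^d are d-tuples, whose canonical sigma-algebra is the one
   generated by the coordinate maps, i.e. the Borel sigma-algebra of R^d. *)
Section gaussian_sequence_model.
Context {R : realType} {d : nat}.

Definition linear_functional (theta : d.-tuple R) : R :=
  \sum_(j < d) tnth theta j.

Definition l0_norm (theta : d.-tuple R) : nat :=
  #|[pred j : 'I_d | tnth theta j != 0]|.

Definition sparse (s : nat) : set (d.-tuple R) :=
  [set theta | (l0_norm theta <= s)%N].

Context {disp : measure_display} {Omega : measurableType disp}.

Definition observation (P : probability Omega R) (xi : 'I_d -> {RV P >-> R})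
    (sigma : R) (theta : d.-tuple R) (w : Omega) : d.-tuple R :=
  [tuple tnth theta j + sigma * xi j w | j < d].

(* Extended-real valued: the risk is +oo when the squared error is not
   integrable. *)
Definition quadratic_risk (P : probability Omega R)
    (xi : 'I_d -> {RV P >-> R}) (sigma : R) (T : d.-tuple R -> R)
    (theta : d.-tuple R) : \bar R :=
  ('E_P[fun w => ((T (observation xi sigma theta w)
                   - linear_functional theta) ^+ 2)%R])%E.

Definition max_risk (P : probability Omega R) (xi : 'I_d -> {RV P >-> R})
    (sigma : R) (T : d.-tuple R -> R) (Theta : set (d.-tuple R)) : \bar R :=
  ereal_sup [set quadratic_risk xi sigma T theta | theta in Theta].

End gaussian_sequence_model.

(* Main.v *)
Require Import Defs.
From HB Require Import structures.
From mathcomp Require Import all_boot all_order all_algebra.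
From mathcomp Require Import all_classical all_reals all_analysis.
From mathcomp Require Import measurable_realfun ring lra.

Set Implicit Arguments.
Unset Strict Implicit.
Unset Printing Implicit Defensive.

Import Order.TTheory GRing.Theory Num.Theory.
Import numFieldNormedType.Exports.

Local Open Scope classical_set_scope.
Local Open Scope ring_scope.

(* The constrained-risk argument with a block prior.  Cut [s * (d %/ s)] of the
   coordinates into [s] blocks and let the mean have one spike of height
   [a * sigma] at a uniformly chosen place in each block, with
   [a ^ 2 = ln (1 + d ln d / (8 s ^ 2))].  Against pure noise, the second moment
   of the likelihood ratio of this mixture is
   [(1 + (e ^ (a ^ 2) - 1) / (d %/ s)) ^ s <= d ^ (1 / 4)].  If the risk at 0
   were below [sigma ^ 2 d ^ (1 / 4) / 256], then [|T|] would rarely exceed half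
   of [L = s a sigma] under noise, hence, by Cauchy-Schwarz, not often enough
   under the mixture either, which forces a risk of order [(s a sigma) ^ 2] at
   some [s]-sparse mean. *)

(** * Measures with a density, and integrals against weighted laws *)

Section density_measure.
Local Open Scope ereal_scope.
Context d (T : measurableType d) (R : realType).

(* The two proofs are arguments so that the measure structure can be inferred. *)
Definition mdensity (mu : {measure set T -> \bar R}) (W : T -> R)
  (mW : measurable_fun [set: T] W) (W0 : forall x, (0 <= W x)%R)
  (A : set T) : \bar R := \int[mu]_(x in A) (W x)%:E.

Variables (mu : {measure set T -> \bar R}) (W : T -> R).
Hypotheses (mW : measurable_fun [set: T] W) (W0 : forall x, (0 <= W x)%R).

Let mdensity0 : mdensity mu mW W0 set0 = 0.
Proof. exact: integral_set0. Qed.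

Let mdensity_ge0 A : 0 <= mdensity mu mW W0 A.
Proof. by apply: integral_ge0 => x _; rewrite lee_fin. Qed.

Let mdensity_sigma_additive : semi_sigma_additive (mdensity mu mW W0).
Proof.
move=> F mF tF mUF; rewrite /mdensity ge0_integral_bigcup//; last 2 first.
- by apply/measurable_EFinP; exact: measurable_funTS.
- by move=> x _; rewrite lee_fin.
apply: is_cvg_ereal_nneg_natsum_cond => n _ _.
by apply: integral_ge0 => x _; rewrite lee_fin.
Qed.

HB.instance Definition _ := isMeasure.Build _ _ _ (mdensity mu mW W0)
  mdensity0 mdensity_ge0 mdensity_sigma_additive.

Import HBNNSimple.

(** Monotone convergence along simple approximations of [f] on both sides reduces the formula to
    indicators of level sets, where it is the definition of [mdensity]. *)
Lemma ge0_integral_mdensity (f : T -> \bar R) :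
  measurable_fun [set: T] f -> (forall x, 0 <= f x) ->
  \int[mdensity mu mW W0]_x f x = \int[mu]_x (f x * (W x)%:E).
Proof.
move=> mf f0; pose h := nnsfun_approx measurableT mf.
have hf x : (h n x)%:E @[n --> \oo] --> f x by exact: cvg_nnsfun_approx.
have ndh x : nondecreasing_seq (fun n => (h n x)%:E).
  by move=> a b ab; rewrite lee_fin; exact/lefP/nd_nnsfun_approx.
have -> : \int[mdensity mu mW W0]_x f x =
    lim (\int[mdensity mu mW W0]_x (h n x)%:E @[n --> \oo]).
  rewrite -monotone_convergence//.
  - by apply: eq_integral => x _; exact/esym/cvg_lim.
  - by move=> n; exact/measurable_EFinP/measurable_funP.
  - by move=> n x _; rewrite lee_fin.
have mhW n : measurable_fun [set: T] (fun x => (h n x)%:E * (W x)%:E).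
  by apply: emeasurable_funM => //; exact/measurable_EFinP.
have -> : \int[mu]_x (f x * (W x)%:E) =
    lim (\int[mu]_x ((h n x)%:E * (W x)%:E) @[n --> \oo]).
  rewrite -monotone_convergence//.
  - by apply: eq_integral => x _; apply/esym/cvg_lim => //; exact: cvgeZr.
  - by move=> n x _; rewrite mule_ge0// lee_fin.
  - by move=> x _ a b ab; rewrite lee_wpmul2r// ?lee_fin//; exact: ndh.
apply/congr_lim/funext => n.
transitivity (\int[mdensity mu mW W0]_x
   (\sum_(y \in range (h n)) (y * \1_(h n @^-1` [set y]) x)%:E)).
  by apply: eq_integral => t tE; rewrite fimfunE -fsumEFin.
have mindic r : measurable_fun [set: T]
    (fun x => (r * \1_(h n @^-1` [set r]) x)%:E).
  by apply/measurable_EFinP/measurable_funM.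
rewrite ge0_integral_fsum//; last by move=> m y Ey; exact: nnfun_muleindic_ge0.
transitivity (\int[mu]_x (\sum_(y \in range (h n))
    (y * \1_(h n @^-1` [set y]) x)%:E * (W x)%:E)); last first.
  apply: eq_integral => x _.
  rewrite -ge0_mule_fsuml => [|y]; last exact: nnfun_muleindic_ge0.
  by rewrite fsumEFin // -(fimfunE _ x).
rewrite ge0_integral_fsum//; last 2 first.
  - by move=> y; apply: emeasurable_funM => //; exact/measurable_EFinP.
  - by move=> m y Ey; rewrite mule_ge0 ?nnfun_muleindic_ge0 ?lee_fin.
apply: eq_fsbigr => r rhn.
under eq_integral do rewrite EFinM.
rewrite integralZl_indic_nnsfun//.
under [RHS]eq_integral do rewrite EFinM -muleA.
rewrite ge0_integralZl//.
- under [in RHS]eq_integral do rewrite muleC.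
  rewrite [in RHS](eq_integral ((EFin \o W) \_ (h n @^-1` [set r]))); last first.
    by move=> x xE; rewrite epatch_indic.
  by rewrite -integral_mkcondr integral_indic// setTI setIT.
- by apply: emeasurable_funM; exact/measurable_EFinP.
- by move=> t Et; rewrite mule_ge0 ?lee_fin.
- by move: rhn; rewrite inE => -[t _ <-]; rewrite lee_fin.
Qed.

End density_measure.

(** The hypothesis says that the pushforward by [X] of the measure with density [W] agrees with
    [c * nu] on measurable sets, so the two integrate every nonnegative [g] alike. This is what lets
    an indicator be replaced by a general function. *)
Lemma ge0_integral_weighted_law d d' (T : measurableType d)
    (Y : measurableType d') (R : realType)
    (mu : {measure set T -> \bar R}) (nu : {measure set Y -> \bar R})
    (X : T -> Y) (W : T -> R) (c : {nonneg R}) :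
  measurable_fun [set: T] X -> measurable_fun [set: T] W ->
  (forall x, 0 <= W x) ->
  (forall B, measurable B ->
    (\int[mu]_x (\1_B (X x) * W x)%:E = c%:num%:E * nu B)%E) ->
  forall g : Y -> R, measurable_fun [set: Y] g -> (forall y, 0 <= g y) ->
    (\int[mu]_x (g (X x) * W x)%:E = c%:num%:E * \int[nu]_y (g y)%:E)%E.
Proof.
move=> mX mW W0 lawX g mg g0.
have mEg : measurable_fun [set: Y] (EFin \o g) by exact/measurable_EFinP.
rewrite -ge0_integral_mscale//; last by move=> y _; rewrite lee_fin.
transitivity (\int[pushforward (mdensity mu mW W0) X]_y (g y)%:E)%E; last first.
  apply: eq_measure_integral => B mB _; rewrite /mscale/=; rewrite -[RHS]lawX//.
  rewrite /pushforward/= /mdensity integral_mkcond/=.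
  by apply: eq_integral => x _; rewrite epatch_indic/= -EFinM mulrC.
rewrite (ge0_integral_pushforward mX)//=; last by move=> y _; rewrite lee_fin.
rewrite preimage_setT ge0_integral_mdensity//=.
- by apply/measurable_EFinP; exact: measurableT_comp.
- by move=> x; rewrite lee_fin.
Qed.

(** * One-dimensional Gaussian shifts *)

(** The translated measure gives half-open intervals their length, hence is Lebesgue measure by
    uniqueness. *)
Lemma ge0_integral_shift (R : realType) (t : R) (f : R -> \bar R) :
  measurable_fun [set: R] f -> (forall x, 0 <= f x)%E ->
  (\int[lebesgue_measure]_x f (x + t)%R = \int[lebesgue_measure]_x f x)%E.
Proof.
move=> mf f0.
pose phi : R -> measurableTypeR R := fun x => x + t.
have mphi : measurable_fun [set: measurableTypeR R] phi.
  exact: measurable_funD.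
rewrite [RHS](@eq_measure_integral _ _ _ _ (pushforward lebesgue_measure phi))//.
  by rewrite (ge0_integral_pushforward mphi)// preimage_setT.
move=> A mA _; apply: lebesgue_measure_unique => //= _ [[a b]] _ <-.
rewrite /pushforward.
have -> : phi @^-1` `]a, b]%classic = `]a - t, b - t]%classic.
  by apply/seteqP; split=> x /=; rewrite /phi !in_itv/= ltrBlDr lerBrDr.
rewrite !lebesgue_measure_itv/= !lte_fin ltrD2r.
by case: ifP => // _; rewrite -!EFinB; congr (_%:E); ring.
Qed.

Lemma ge0_integral_normal_prob (R : realType) (m s : R) (g : R -> R) :
  measurable_fun [set: R] g -> (forall x, 0 <= g x) ->
  (\int[normal_prob m s]_x (g x)%:E =
   \int[lebesgue_measure]_x (g x * normal_pdf m s x)%:E)%E.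
Proof.
move=> mg g0; have mN := measurable_normal_pdf m s.
have := @ge0_integral_mdensity _ _ _ lebesgue_measure _ mN (normal_pdf_ge0 m s)
  (EFin \o g).
move=> /= <-//; last exact/measurable_EFinP.
Qed.

(** One-dimensional Cameron-Martin formula. After translating by [t], the exponents combine as [t (x
    + t) - t ^ 2 / 2 - (x + t) ^ 2 / 2 = - x ^ 2 / 2]. *)
Lemma ge0_integral_normal_tilt (R : realType) (t : R) (g : R -> R) :
  measurable_fun [set: R] g -> (forall x, 0 <= g x) ->
  (\int[normal_prob 0 1]_x (g x * expR (t * x - t ^+ 2 / 2))%:E =
   \int[normal_prob 0 1]_x (g (x + t))%:E)%E.
Proof.
move=> mg g0.
have mexp : measurable_fun [set: R] (fun x : R => expR (t * x - t ^+ 2 / 2)).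
apply: measurableT_comp => //; exact: measurable_funB.
have mgt : measurable_fun [set: R] (fun x : R => g (x + t)).
by apply: (measurableT_comp mg); exact: measurable_funD.
rewrite !ge0_integral_normal_prob//; last 2 first.
-  exact: measurable_funM.
-  by move=> x; rewrite mulr_ge0// expR_ge0.
pose F x := (g x * expR (t * x - t ^+ 2 / 2) * normal_pdf 0 1 x)%:E.
transitivity (\int[lebesgue_measure]_x F (x + t)%R)%E.
  apply/esym/ge0_integral_shift => [|x].
    apply/measurable_EFinP; apply: measurable_funM; first exact: measurable_funM.
    exact: measurable_normal_pdf.
  by rewrite lee_fin !mulr_ge0 ?expR_ge0 ?normal_pdf_ge0.
apply: eq_integral => x _; congr (_%:E); rewrite -mulrA; congr (_ * _).
rewrite normal_pdfE ?oner_eq0//= mulrCA; congr (_ * _).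
by rewrite /normal_fun -expRD; congr expR; rewrite !subr0 expr1n; field.
Qed.

Lemma integral_normal_expR (R : realType) (t : R) :
  (\int[normal_prob 0 1]_x (expR (t * x - t ^+ 2 / 2))%:E = 1)%E.
Proof.
have := @ge0_integral_normal_tilt R t (cst 1) (measurable_cst _) (fun=> ler01).
rewrite [RHS](eq_integral (cst 1%E))// integral_cst//= mul1e probability_setT => <-.
by apply: eq_integral => x _; rewrite /= mul1r.
Qed.

(** * Product formula for independent standard normal variables *)

Section independent_product.
Context {disp : measure_display} {Omega : measurableType disp} {R : realType}.
Variables (P : probability Omega R) (d : nat) (xi : 'I_d -> {RV P >-> R}).
Hypothesis xi_iid : iid_standard_normal xi.
Local Open Scope ereal_scope.

Let N01 := @normal_prob R 0 1.

(* Independence only speaks about indicators [g i]; they are replaced by general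
   functions one coordinate at a time, the other factors acting as a weight. *)
Lemma expectation_prod_iid (g : 'I_d -> R -> R) :
  (forall i, measurable_fun [set: R] (g i)) -> (forall i x, (0 <= g i x)%R) ->
  (forall i, \int[N01]_x (g i x)%:E < +oo) ->
  \int[P]_w (\prod_i g i (xi i w))%:E = \prod_i \int[N01]_x (g i x)%:E.
Proof.
(* Coordinates below [k] may carry general functions, the others carry indicators. The base case
   [k = 0] is independence itself; [k = d] is the claim. *)
suff H k : forall g : 'I_d -> R -> R,
    (forall i, measurable_fun [set: R] (g i)) ->
    (forall i x, (0 <= g i x)%R) ->
    (forall i, \int[N01]_x (g i x)%:E < +oo) ->
    (forall i : 'I_d, (k <= i)%N ->
       exists B, measurable B /\ g i = \1_B) ->
  \int[P]_w (\prod_i g i (xi i w))%:E = \prod_i \int[N01]_x (g i x)%:E.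
  by move=> mg g0 gfin; apply: (H d) => // i; rewrite leqNgt ltn_ord.
case: xi_iid => law indep.
elim: k => [|k IH] {}g mg g0 gfin gB.
  have [B BE] := choice (fun i => gB i isT).
  have mB i : measurable (B i) by case: (BE i).
  transitivity (P (\bigcap_(i in [set` [set: 'I_d]%SET]) (xi i @^-1` B i))).
    set A := \bigcap_(i in _) _.
    have mA : measurable A.
      by apply: fin_bigcap_measurable => //= i _; exact: measurable_funPTI.
    transitivity (\int[P]_w (\1_A w)%:E); last by rewrite integral_indic// setIT.
    apply: eq_integral => w _; congr (_%:E).
    have [wB|] := pselect (forall i, B i (xi i w)).
      rewrite indicE mem_set; last by move=> i _; exact: wB.
      by rewrite big1// => i _; rewrite (BE i).2 indicE mem_set.
    move=> /existsNP[i nBi]; rewrite indicE memNset; last first.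
      by move=> /(_ i) wB; apply: nBi; apply: wB; rewrite /= inE.
    by rewrite (bigD1 i)//= (BE i).2 indicE memNset// mul0r.
  rewrite indep//; apply: eq_big => [i|i _]; first by rewrite inE.
  rewrite (BE i).2 integral_indic; [|by []|exact: mB].
  by rewrite setIT; exact: law.
(* For [k >= d] the indicator condition is vacuous; otherwise coordinate [k] is the one to be
   generalised. *)
have [dk|kd] := leqP d k.
  by apply: IH => // i ki; have := leq_trans dk ki; rewrite leqNgt ltn_ord.
pose i0 := Ordinal kd.
pose W w := (\prod_(i | i != i0) g i (xi i w))%R.
have mW : measurable_fun [set: Omega] W.
  rewrite [W](_ : _ = fun w =>
      (\prod_(i <- [seq i <- index_enum 'I_d | i != i0]) g i (xi i w))%R).
    by apply: measurable_prod => i _; exact: measurableT_comp.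
  by apply/funext => w; rewrite big_filter.
(* The finiteness assumption makes [c] a real number, as the weighted-law lemma requires. *)
pose c := \prod_(i | i != i0) \int[N01]_x (g i x)%:E.
have int_ge0 i : 0 <= \int[N01]_x (g i x)%:E.
  by apply: integral_ge0 => x _; rewrite lee_fin.
have c0 : 0 <= c by exact: prode_ge0.
have cfin : c \is a fin_num.
  by apply: prode_fin_num => i _; rewrite ge0_fin_numE.
pose c' := NngNum (fine_ge0 c0).
rewrite (bigD1 i0)//= -/c muleC.
under eq_integral do rewrite (bigD1 i0)//= -/(W _).
have -> : c = c'%:num%:E by rewrite /= fineK.
apply: (@ge0_integral_weighted_law _ _ _ _ _ _ N01 (xi i0) W c') => //.
- exact: (measurable_funPT (xi i0)).
- by move=> w; rewrite /W prodr_ge0.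
(* With an indicator put back in coordinate [i0], the identity is the induction hypothesis. *)
- move=> B mB.
  pose g' i := if i == i0 then \1_B else g i.
  have g'i0 : g' i0 = \1_B by rewrite /g' eqxx.
  have g'n i : i != i0 -> g' i = g i by rewrite /g' => /negbTE ->.
  transitivity (\int[P]_w (\prod_i g' i (xi i w))%:E).
    apply: eq_integral => w _; rewrite (bigD1 i0)//= g'i0; congr (_ * _)%:E.
    by apply: eq_bigr => i /g'n ->.
  rewrite IH.
  - rewrite (bigD1 i0)//= g'i0 integral_indic// setIT muleC; congr (_ * _).
    by rewrite fineK//; apply: eq_bigr => i /g'n ->.
  - by move=> i; rewrite /g'; case: ifP.
  - by move=> i x; rewrite /g'; case: ifP => // _; rewrite indicE.
  - move=> i; rewrite /g'; case: ifP => // _.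
    by rewrite integral_indic// setIT (le_lt_trans (probability_le1 _ _))// ltry.
  - move=> i ki; rewrite /g'; case: eqVneq => [_|ii0]; first by exists B.
    apply: gB; rewrite ltn_neqAle ki andbT.
    by apply: contra ii0 => /eqP kiE; apply/eqP/val_inj.
- exact: mg.
Qed.
End independent_product.

(** * Boxes determine finite measures on tuples *)

Lemma measurable_tuple_box d (T : measurableType d) n (B : 'I_n -> set T) :
  (forall i, measurable (B i)) ->
  measurable [set y : n.-tuple T | forall i, B i (tnth y i)].
Proof.
move=> mB.
rewrite [X in measurable X](_ : _ =
    \bigcap_(i in [set: 'I_n]) ((fun y => tnth y i) @^-1` B i)).
  apply: fin_bigcap_measurable => // i _.
  by rewrite -[X in measurable X]setTI; exact: measurable_tnth.
by apply/seteqP; split=> [y /= yB i _|y /= yB i]; exact: yB.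
Qed.

Lemma indic_tuple_box (R : realType) T n (B : 'I_n -> set T) (y : n.-tuple T) :
  \1_[set y : n.-tuple T | forall i, B i (tnth y i)] y =
  \prod_i \1_(B i) (tnth y i) :> R.
Proof.
have [yB|/existsNP[i nBi]] := pselect (forall i, B i (tnth y i)).
  by rewrite indicE mem_set// big1// => i _; rewrite indicE mem_set.
rewrite indicE memNset; last by move=> /(_ i).
by rewrite (bigD1 i)//= indicE memNset// mul0r.
Qed.

(** Boxes are stable under intersection and generate the product sigma-algebra; the whole space is a
    box of finite mass. *)
Lemma tuple_measure_unique d (T : measurableType d) (R : realType) n
    (m1 m2 : {measure set (n.-tuple T) -> \bar R}) :
  (forall B : 'I_n -> set T, (forall i, measurable (B i)) ->
    m1 [set y | forall i, B i (tnth y i)] =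
    m2 [set y | forall i, B i (tnth y i)]) ->
  (m1 [set: n.-tuple T] < +oo)%E ->
  forall A, measurable A -> m1 A = m2 A.
Proof.
move=> m12 m1fin A mA.
pose box (B : 'I_n -> set T) := [set y : n.-tuple T | forall i, B i (tnth y i)].
pose G : set (set (n.-tuple T)) :=
  [set box B | B in [set B | forall i, measurable (B i)]].
have GT : G [set: n.-tuple T].
  by exists (fun=> [set: T]) => //; apply/seteqP; split.
apply: (measure_unique G (fun=> setT)) => //.
- apply/seteqP; split.
    apply: smallest_sub; first exact: smallest_sigma_algebra.
    apply: (@big_ind _ (fun X : set (set (n.-tuple T)) => X `<=` <<s G >>)) => //.
      by move=> X Y XG YG Z [/XG|/YG].
    move=> i _ _ [B mB <-]; apply: sub_sigma_algebra.
    (* A generating coordinate preimage is a box whose other sides are full. *)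
    exists (fun j => if j == i then B else setT).
      by move=> j; case: ifP.
    rewrite setTI; apply/seteqP; split=> [y /(_ i)|y /= yB j].
      by rewrite eqxx.
    by case: eqP => // ->.
  apply: smallest_sub; first exact: sigma_algebra_measurable.
  by move=> _ [B mB <-]; exact: measurable_tuple_box.
- move=> _ _ [B mB <-] [C mC <-]; exists (fun i => B i `&` C i).
    by move=> i; exact: measurableI.
  apply/seteqP; split=> [y yBC|y [yB yC] i]; last by split; [exact: yB|exact: yC].
  by split=> i; case: (yBC i).
- by rewrite bigcup_const//; exists 0%N.
- by move=> _ [B mB <-]; exact: m12.
Qed.

(** * Likelihood ratios in the Gaussian sequence model *)

Section likelihood_ratio.
Context {disp : measure_display} {Omega : measurableType disp} {R : realType}.
Variables (P : probability Omega R) (d : nat) (xi : 'I_d -> {RV P >-> R}).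
Variable (sigma : R).

Lemma measurable_observation (theta : d.-tuple R) :
  measurable_fun [set: Omega] (observation xi sigma theta).
Proof.
apply/measurable_fun_tnthP => i.
rewrite (_ : _ \o _ = fun w => tnth theta i + sigma * xi i w).
  by apply: measurable_funD => //; exact: measurable_funM.
by apply/funext => w; rewrite /observation/= tnth_mktuple.
Qed.

(** Density of the law of the observation at mean [theta] relative to mean 0, written on [Omega]
    through the noise: the Cameron-Martin density for a shift of [xi] by [theta / sigma]. *)
Definition likelihood_ratio (theta : d.-tuple R) (w : Omega) : R :=
  \prod_i expR (tnth theta i / sigma * xi i w - (tnth theta i / sigma) ^+ 2 / 2).

Lemma measurable_likelihood_ratio theta :
  measurable_fun [set: Omega] (likelihood_ratio theta).
Proof.
apply: measurable_prod => i _; apply: measurableT_comp => //.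
by apply: measurable_funB => //; exact: measurable_funM.
Qed.

Lemma likelihood_ratio_ge0 theta w : 0 <= likelihood_ratio theta w.
Proof. by apply: prodr_ge0 => i _; exact: expR_ge0. Qed.

Hypotheses (xi_iid : iid_standard_normal xi) (sigma_gt0 : 0 < sigma).

(** On boxes both sides factor over the coordinates, and the factors agree by the one-dimensional
    tilt formula; uniqueness of measures extends this to all events. *)
Lemma likelihood_ratioE (theta : d.-tuple R) (A : set (d.-tuple R)) :
  measurable A ->
  P (observation xi sigma theta @^-1` A) =
  (\int[P]_w (\1_A (observation xi sigma [tuple 0 | _ < d] w)
              * likelihood_ratio theta w)%:E)%E.
Proof.
move=> mA; set obs0 := observation xi sigma [tuple 0 | _ < d].
have mobs0 : measurable_fun setT obs0 by exact: measurable_observation.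
have mobs := measurable_observation theta.
pose L := mdensity P (measurable_likelihood_ratio theta)
  (likelihood_ratio_ge0 theta).
transitivity (pushforward L obs0 A); last first.
  rewrite /pushforward /L /mdensity integral_mkcond.
  by apply: eq_integral => w _; rewrite epatch_indic/= -EFinM mulrC.
apply: (@tuple_measure_unique _ _ _ _
  (pushforward P (observation xi sigma theta)) (pushforward L obs0)) => //;
  last first.
  apply: (@le_lt_trans _ _ 1%E); rewrite ?ltry//; apply: probability_le1.
  by rewrite -[X in measurable X]setTI; exact: mobs.
move=> B mB; rewrite /pushforward /L /mdensity/=.
have mbox := measurable_tuple_box mB; set box := [set y | _] in mbox *.
pose t i := tnth theta i / sigma.
(* The side [B i] in units of the noise, so that the mean becomes a shift by [t i]. *)
pose f i x : R := \1_(B i) (sigma * x).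
have tE i x : tnth theta i + sigma * x = sigma * (x + t i).
  by rewrite mulrDr addrC /t mulrCA mulfV ?mulr1// gt_eqF.
have mf i : measurable_fun [set: R] (f i).
  by apply: measurableT_comp => //; exact: mulrl_measurable.
have f0 i x : 0 <= f i x by rewrite /f indicE.
have mft i : measurable_fun [set: R] (fun x => f i (x + t i)).
  by apply: measurableT_comp => //; exact: measurable_funD.
have tilt i := ge0_integral_normal_tilt (t i) (mf i) (f0 i).
have ft_fin i : (\int[normal_prob 0 1]_x (f i (x + t i))%:E < +oo)%E.
  apply: (@le_lt_trans _ _ (\int[normal_prob (0:R) 1]_x (cst 1 x))%E).
    apply: ge0_le_integral => //=.
    - by move=> x _; rewrite lee_fin.
    - by apply/measurable_EFinP; exact: mft.
    - by move=> x _; rewrite lee_fin /f indicE; case: (_ \in _).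
  by rewrite integral_cst//= mul1e probability_setT ltry.
transitivity (\int[P]_w (\prod_i f i (xi i w + t i))%:E)%E.
  transitivity (\int[P]_w (\1_(observation xi sigma theta @^-1` box) w)%:E)%E.
    rewrite integral_indic ?setIT//.
    by rewrite -[X in measurable X]setTI; exact: mobs.
  apply: eq_integral => w _.
  rewrite -[X in X%:E]/(\1_box (observation xi sigma theta w)).
  rewrite indic_tuple_box; congr (_%:E); apply: eq_bigr => i _.
  by rewrite tnth_mktuple tE.
rewrite (expectation_prod_iid xi_iid (g := fun i x => f i (x + t i)))//.
under eq_bigr do rewrite -tilt.
rewrite -(expectation_prod_iid xi_iid); first last.
- by move=> i; rewrite tilt.
- by move=> i x; rewrite mulr_ge0// expR_ge0.
- move=> i; apply: measurable_funM => //; apply: measurableT_comp => //.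
  exact: measurable_funB.
rewrite [RHS]integral_mkcond; apply: eq_integral => w _.
rewrite epatch_indic/= -EFinM -[\1__ w]/(\1_box (obs0 w)) indic_tuple_box.
rewrite mulrC -big_split/=.
congr (_%:E); apply: eq_bigr => i _.
by rewrite tnth_mktuple tnth_mktuple add0r.
Qed.

End likelihood_ratio.

(** * Testing pure noise against a finite mixture *)

Section mixture.
Context {disp : measure_display} {Omega : measurableType disp} {R : realType}.
Variables (P : probability Omega R) (d : nat) (xi : 'I_d -> {RV P >-> R}).
Variable (sigma : R).
Hypotheses (xi_iid : iid_standard_normal xi) (sigma_gt0 : 0 < sigma).

(** In each coordinate the tilts by [t] and [t'] multiply to [e ^ (t t')] times the tilt by
    [t + t'], which has mean 1. *)
Lemma expectation_likelihood_ratioM (theta theta' : d.-tuple R) :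
  (\int[P]_w (likelihood_ratio xi sigma theta w
              * likelihood_ratio xi sigma theta' w)%:E =
   (expR (\sum_i tnth theta i * tnth theta' i / sigma ^+ 2))%:E)%E.
Proof.
pose t i := tnth theta i / sigma; pose t' i := tnth theta' i / sigma.
pose e i (x : R) := expR ((t i + t' i) * x - (t i + t' i) ^+ 2 / 2).
pose g i (x : R) := expR (t i * t' i) * e i x.
have me i : measurable_fun [set: R] (e i).
  by apply: measurableT_comp => //; exact: measurable_funB.
have Ig i : (\int[normal_prob 0 1]_x (g i x)%:E = (expR (t i * t' i))%:E)%E.
  under eq_integral do rewrite EFinM.
  rewrite ge0_integralZl//= ?integral_normal_expR ?mule1//.
  - by apply/measurable_EFinP; exact: me.
  - by move=> x _; rewrite lee_fin expR_ge0.
transitivity (\int[P]_w (\prod_i g i (xi i w))%:E)%E.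
  apply: eq_integral => w _; rewrite -big_split/=; congr (_%:E).
  apply: eq_bigr => i _; rewrite /g /e -!expRD -/(t i) -/(t' i); congr expR.
  by field.
rewrite (expectation_prod_iid xi_iid).
- under eq_bigr do rewrite Ig.
  rewrite prodEFin -expR_sum; congr (expR _)%:E; apply: eq_bigr => i _.
  by rewrite /t /t' mulrACA -invfM.
- by move=> i; exact: measurable_funM.
- by move=> i x; rewrite mulr_ge0 ?expR_ge0.
- by move=> i; rewrite Ig ltry.
Qed.

(** A linearised Cauchy-Schwarz inequality for the unnormalised sum [S] of likelihood ratios, with
    [lam] left free for balancing. The event is dropped from the [S ^ 2] term, whose expectation is
    explicit. *)
Lemma mixture_probability_le (F : finType) (theta : F -> d.-tuple R)
    (A : set (d.-tuple R)) (lam : R) : measurable A -> 0 < lam ->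
  (2%:E * \sum_f P (observation xi sigma (theta f) @^-1` A) <=
   lam%:E * P (observation xi sigma [tuple 0%R | _ < d] @^-1` A) +
   (lam^-1 * \sum_f \sum_f'
      expR (\sum_i tnth (theta f) i * tnth (theta f') i / sigma ^+ 2))%:E)%E.
Proof.
move=> mA lam0; set obs0 := observation xi sigma [tuple 0%R | _ < d].
pose L f := likelihood_ratio xi sigma (theta f).
have mobs0 : measurable_fun setT obs0 by exact: measurable_observation.
have mL f : measurable_fun setT (L f) by exact: measurable_likelihood_ratio.
have L0 f w : 0 <= L f w by exact: likelihood_ratio_ge0.
pose S w := \sum_f L f w.
have mS : measurable_fun setT S by exact: measurable_sum.
have S0 w : 0 <= S w by exact: sumr_ge0.
have m1A : measurable_fun setT (fun w => \1_A (obs0 w) : R).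
  exact: measurableT_comp.
have lhs : (\sum_f P (observation xi sigma (theta f) @^-1` A) =
            \int[P]_w (\1_A (obs0 w) * S w)%:E)%E.
  under eq_bigr do rewrite (likelihood_ratioE xi_iid)//.
  rewrite -ge0_integral_sum//.
  - by apply: eq_integral => w _; rewrite sumEFin mulr_sumr.
  - by move=> f; apply/measurable_EFinP; apply: measurable_funM => //; exact: mL.
  - by move=> f w _; rewrite lee_fin; apply: mulr_ge0; [rewrite indicE|exact: L0].
have P0 : (P (obs0 @^-1` A) = \int[P]_w (\1_A (obs0 w))%:E)%E.
  transitivity (\int[P]_w (\1_(obs0 @^-1` A) w)%:E)%E => //.
  rewrite integral_indic ?setIT//.
  by rewrite -[X in measurable X]setTI; exact: mobs0.
have S2 : (\int[P]_w (S w ^+ 2)%:E = (\sum_f \sum_f'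
      expR (\sum_i tnth (theta f) i * tnth (theta f') i / sigma ^+ 2))%:E)%E.
  transitivity (\int[P]_w \sum_f \sum_f' (L f w * L f' w)%:E)%E.
    apply: eq_integral => w _; rewrite expr2 mulr_suml -sumEFin.
    by apply: eq_bigr => f _; rewrite mulr_sumr sumEFin.
  have mLL f f' : measurable_fun setT (fun w => (L f w * L f' w)%:E).
    by apply/measurable_EFinP; exact: measurable_funM.
  have LL0 f f' w : (0 <= (L f w * L f' w)%:E)%E by rewrite lee_fin mulr_ge0.
  rewrite ge0_integral_sum//; last 2 first.
  - by move=> f; exact: emeasurable_sum.
  - by move=> f w _; exact: sume_ge0.
  rewrite -sumEFin; apply: eq_bigr => f _.
  rewrite ge0_integral_sum// -sumEFin; apply: eq_bigr => f' _.
  exact: expectation_likelihood_ratioM.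
rewrite lhs P0 EFinM -S2 -!ge0_integralZl//; first last.
- by move=> w _; rewrite lee_fin; apply: mulr_ge0; [rewrite indicE|exact: S0].
- by apply/measurable_EFinP; exact: measurable_funM.
- by rewrite lee_fin ltW.
- exact/measurable_EFinP.
- by rewrite lee_fin invr_ge0 ltW.
- by move=> w _; rewrite lee_fin sqr_ge0.
- by apply/measurable_EFinP; exact: measurable_funX.
have mlA : measurable_fun setT (fun w => lam%:E * (\1_A (obs0 w))%:E)%E.
  by apply/measurable_EFinP; exact: measurable_funM.
have mlS : measurable_fun setT (fun w => (lam^-1)%:E * (S w ^+ 2)%:E)%E.
  by apply/measurable_EFinP; apply: measurable_funM => //; exact: measurable_funX.
have lA0 w : (0 <= lam%:E * (\1_A (obs0 w))%:E)%E.
  by rewrite lee_fin; apply: mulr_ge0; [exact: ltW|rewrite indicE].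
have lS0 w : (0 <= (lam^-1)%:E * (S w ^+ 2)%:E)%E.
  by rewrite lee_fin; apply: mulr_ge0; [rewrite invr_ge0 ltW|exact: sqr_ge0].
rewrite -ge0_integralD//; apply: ge0_le_integral => //.
- move=> w _; rewrite -EFinM lee_fin; apply: mulr_ge0 => //.
  by apply: mulr_ge0 => //; rewrite indicE.
- by apply/measurable_EFinP; do 2 apply: measurable_funM => //.
- exact: emeasurable_funD.
move=> w _; rewrite -!EFinM -EFinD lee_fin indicE.
(* AM-GM: [2 S <= lam + S ^ 2 / lam]. *)
case: (_ \in _); last by rewrite mul0r !mulr0 add0r mulr_ge0 ?invr_ge0 ?sqr_ge0 ?ltW.
have -> : lam * true%:R + lam^-1 * S w ^+ 2 =
    2 * (true%:R * S w) + lam^-1 * (S w - lam) ^+ 2.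
  by rewrite mul1r mulr1; field; rewrite gt_eqF.
by rewrite lerDl mulr_ge0 ?invr_ge0 ?sqr_ge0 ?ltW.
Qed.

(* A test for the event [|T| < M / 2] separates 0 from the mixture: its error
   under 0 is controlled by the risk at 0, and transfers to the mixture at the
   price of the second moment [V] of the likelihood ratio. *)
Lemma constrained_risk (F : finType) (theta : F -> d.-tuple R)
    (T : d.-tuple R -> R) (M r rho V : R) :
  measurable_fun [set: d.-tuple R] T -> 0 < M -> 0 < V -> (0 < #|F|)%N ->
  (forall f, linear_functional (theta f) = M) ->
  (forall f, (quadratic_risk xi sigma T (theta f) <= r%:E)%E) ->
  (quadratic_risk xi sigma T [tuple 0%R | _ < d] <= rho%:E)%E ->
  \sum_f \sum_f' expR (\sum_i tnth (theta f) i * tnth (theta f') i / sigma ^+ 2)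
    <= #|F|%:R ^+ 2 * V ->
  3 / 16 * M ^+ 2 <= r + V * rho.
Proof.
move=> mT M0 V0 F0 LM risk_r risk_rho chi2.
pose N : R := #|F|%:R; have N0 : 0 < N by rewrite ltr0n.
pose A := [set y : d.-tuple R | M / 2 <= `|T y|].
have mA : measurable A.
  rewrite [A](_ : _ = (fun y => `|T y|) @^-1` `[M / 2, +oo[%classic).
    by rewrite -[X in measurable X]setTI; apply: (measurableT_comp _ mT).
  by apply/seteqP; split => y /=; rewrite in_itv/= andbT.
have mO theta' : measurable_fun setT (observation xi sigma theta').
  exact: measurable_observation.
have mOA theta' : measurable (observation xi sigma theta' @^-1` A).
  by rewrite -[X in measurable X]setTI; exact: mO.
pose p theta' := fine (P (observation xi sigma theta' @^-1` A)).
have pE theta' : P (observation xi sigma theta' @^-1` A) = (p theta')%:E.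
  by rewrite fineK// fin_num_measure.
have mrisk theta' : measurable_fun setT (fun w =>
    ((T (observation xi sigma theta' w) - linear_functional theta') ^+ 2)%:E).
  apply/measurable_EFinP; apply: measurable_funX; apply: measurable_funB => //.
  exact: measurableT_comp.
have mind theta' c : measurable_fun setT (fun w =>
    (c%:E * (\1_(observation xi sigma theta' @^-1` A) w)%:E)%E : \bar R).
  by apply/measurable_EFinP; apply: measurable_funM => //; exact: measurable_indic.
have pint theta' (c : R) : 0 <= c ->
    (\int[P]_w (c%:E * (\1_(observation xi sigma theta' @^-1` A) w)%:E)%E
     = (c * p theta')%:E)%E.
  move=> c0; rewrite ge0_integralZl//.
  - by rewrite EFinM -pE integral_indic// setIT.
  - by apply/measurable_EFinP; exact: measurable_indic.
(* Markov's inequality: at mean 0 the target is 0, so the squared error is at least [M ^ 2 / 4] on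
   [A]. *)
have p0 : M ^+ 2 / 4 * p [tuple 0%R | _ < d] <= rho.
  rewrite -lee_fin -pint; last by rewrite divr_ge0// sqr_ge0.
  apply: le_trans risk_rho; rewrite /quadratic_risk unlock.
  apply: ge0_le_integral => //.
  - move=> w _; rewrite lee_fin; apply: mulr_ge0; rewrite ?indicE//.
    by rewrite divr_ge0// sqr_ge0.
  move=> w _; rewrite -EFinM lee_fin.
  rewrite [linear_functional _]big1 ?subr0; last by move=> i _; rewrite tnth_mktuple.
  rewrite indicE; case: (boolP (w \in _)); last by rewrite mulr0 sqr_ge0.
  rewrite inE /A /= mulr1 -(real_normK (num_real (T _))) => MT.
  have -> : M ^+ 2 / 4 = (M / 2) ^+ 2 by field.
  by rewrite ler_sqr ?nnegrE ?normr_ge0// divr_ge0// ltW.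
(* Outside [A] the estimate misses the target [M] by more than [M / 2]; on [A] the indicator term
   alone pays [M ^ 2 / 4]. *)
have pf f : M ^+ 2 / 4 <= r + M ^+ 2 / 4 * p (theta f).
  have M4 : 0 <= M ^+ 2 / 4 by rewrite divr_ge0// sqr_ge0.
  rewrite -lee_fin EFinD -pint//.
  apply: (@le_trans _ _ (quadratic_risk xi sigma T (theta f) +
      \int[P]_w ((M ^+ 2 / 4)%:E *
                 (\1_(observation xi sigma (theta f) @^-1` A) w)%:E))%E);
    last exact: leeD.
  rewrite /quadratic_risk unlock -ge0_integralD//; last 2 first.
  - by move=> w _; rewrite lee_fin sqr_ge0.
  - by move=> w _; rewrite lee_fin; apply: mulr_ge0; rewrite ?indicE.
  rewrite -[leLHS]mule1 -(probability_setT P) -integral_cst//.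
  apply: ge0_le_integral => //.
  - exact: emeasurable_funD.
  move=> w _; rewrite -EFinM -EFinD lee_fin LM.
  rewrite indicE; case: (boolP (w \in _)); first by rewrite mulr1 lerDr sqr_ge0.
  rewrite notin_setE /A /= mulr0 addr0 => /negP; rewrite -ltNge => TM.
  have -> : M ^+ 2 / 4 = (M / 2) ^+ 2 by field.
  rewrite -[leRHS]real_normK ?num_real// ler_sqr ?nnegrE ?normr_ge0//; last first.
    by rewrite divr_ge0// ltW.
  rewrite distrC; move: TM; rewrite ltr_norml => /andP[_ TM].
  by apply: le_trans (ler_norm _); rewrite lerBrDl [leRHS]splitr lerD2r ltW.
have mix : \sum_f p (theta f) <= V * N * p [tuple 0%R | _ < d] + N / 4.
  (* The choice [lam = 2 V N] turns the second-moment bound [N ^ 2 V / lam] into [N / 2], so it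
     costs only [1 / 4] in the average of the [p (theta f)]. *)
  have lam0 : 0 < 2 * V * N by rewrite !mulr_gt0.
  have := @mixture_probability_le F theta A _ mA lam0.
  under eq_bigr do rewrite pE.
  rewrite pE sumEFin -!EFinM -EFinD lee_fin => mix.
  have chi2' : (2 * V * N)^-1 * (\sum_f \sum_f'
      expR (\sum_i tnth (theta f) i * tnth (theta f') i / sigma ^+ 2)) <= N / 2.
    rewrite (_ : N / 2 = (2 * V * N)^-1 * (N ^+ 2 * V)).
      by rewrite ler_pM2l ?invr_gt0.
    by field; rewrite !gt_eqF.
  rewrite -(ler_pM2l (ltr0Sn R 1)); apply: (le_trans mix).
  apply: (le_trans (lerD (lexx _) chi2')).
  have -> : 2 * (V * N * p [tuple 0%R | _ < d] + N / 4) =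
            2 * V * N * p [tuple 0%R | _ < d] + N / 2 by field.
  exact: lexx.
have : \sum_(f : F) M ^+ 2 / 4 <= \sum_f (r + M ^+ 2 / 4 * p (theta f)).
  by apply: ler_sum => f _; exact: pf.
have sum_cst (c : R) : \sum_(f : F) c = c * N by rewrite sumr_const mulr_natr.
rewrite big_split/= -[X in _ <= _ + X]mulr_sumr !sum_cst => sum_pf.
have M4 : 0 <= M ^+ 2 / 4 by rewrite divr_ge0// sqr_ge0.
have mpN : M ^+ 2 / 4 * \sum_f p (theta f) <=
    V * N * rho + M ^+ 2 / 4 * (N / 4).
  apply: (le_trans (ler_wpM2l M4 mix)); rewrite mulrDr lerD2r mulrCA.
  by rewrite ler_wpM2l// mulr_ge0// ltW.
rewrite -(ler_pM2r N0).
(* The constant is [1 / 4 - 1 / 16]. *)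
have -> : 3 / 16 * M ^+ 2 * N = M ^+ 2 / 4 * N - M ^+ 2 / 4 * (N / 4) by field.
rewrite lerBlDr (le_trans sum_pf)// [(r + _) * N]mulrDl -addrA lerD2l.
by rewrite [V * rho * N]mulrAC.
Qed.

End mixture.

(** * The block prior and its second moment *)

Lemma ord_prod_embedding (s m d : nat) : (s * m <= d)%N ->
  exists h : 'I_s * 'I_m -> 'I_d, injective h.
Proof.
move=> smd; have cd : (#|{: 'I_s * 'I_m}| <= d)%N.
  by rewrite card_prod !card_ord.
exists (fun x => widen_ord cd (enum_rank x)) => x y /(congr1 val)/= xy.
by apply: enum_rank_inj; exact: val_inj.
Qed.

Section block_prior.
Context {R : realType} (s m d : nat) (h : 'I_s * 'I_m -> 'I_d).
Hypothesis h_inj : injective h.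
Implicit Types f : {ffun 'I_s -> 'I_m}.

(* Block [k] consists of the coordinates [h (k, _)]. *)
Definition block_spikes (b : R) f : d.-tuple R :=
  [tuple \sum_(k < s) (if h (k, f k) == i then b else 0) | i < d].

Lemma linear_functional_block_spikes b f :
  linear_functional (block_spikes b f) = b *+ s.
Proof.
rewrite /linear_functional; under eq_bigr do rewrite tnth_mktuple.
rewrite exchange_big/=; under eq_bigr => k _.
  rewrite -big_mkcond/= (big_pred1 (h (k, f k))); last first.
    by move=> i; rewrite /= eq_sym.
  over.
by rewrite sumr_const card_ord.
Qed.

Lemma sparse_block_spikes b f : sparse s (block_spikes b f).
Proof.
rewrite /sparse/= /l0_norm.
apply: (@leq_trans #|[set h (k, f k) | k : 'I_s]%SET|); last first.
  by rewrite (leq_trans (leq_imset_card _ _))// card_ord.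
apply: subset_leq_card; apply/fintype.subsetP => i; rewrite inE tnth_mktuple.
apply: contraR => /imsetP ni; apply/eqP/big1 => k _.
by case: eqP => // hk; case: ni; exists k.
Qed.

(** By injectivity of [h], spikes of different blocks never overlap, so only blocks where [f] and
    [f'] choose the same place contribute. *)
Lemma inner_block_spikes b f f' :
  \sum_i tnth (block_spikes b f) i * tnth (block_spikes b f') i =
  \sum_(k < s) (if f k == f' k then b ^+ 2 else 0).
Proof.
under eq_bigr do rewrite !tnth_mktuple mulr_suml.
rewrite exchange_big/=; apply: eq_bigr => k _.
rewrite (bigD1 (h (k, f k)))//= eqxx [X in _ + X]big1 ?addr0; last first.
  by move=> i /negbTE hi; rewrite eq_sym hi mul0r.
rewrite (bigD1 k)//= [X in _ + X]big1 ?addr0; last first.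
  move=> l /negbTE lk; case: eqP => // /h_inj [] /eqP; by rewrite lk.
have -> : (h (k, f' k) == h (k, f k)) = (f k == f' k).
  by rewrite (inj_eq h_inj) xpair_eqE eqxx/= eq_sym.
by case: ifP => _; rewrite ?mulr0.
Qed.

(** For fixed [f] the sum over [f'] factors over blocks: one place of [m] coincides and gives
    [e ^ (a ^ 2)], the other [m - 1] give 1. *)
Lemma chi2_block_spikes (a sigma : R) : 0 < sigma -> (0 < m)%N ->
  \sum_f \sum_f' expR (\sum_i tnth (block_spikes (a * sigma) f) i *
                          tnth (block_spikes (a * sigma) f') i / sigma ^+ 2) =
  #|{ffun 'I_s -> 'I_m}|%:R ^+ 2 * (1 + (expR (a ^+ 2) - 1) / m%:R) ^+ s.
Proof.
move=> sigma0 m0; set e := expR (a ^+ 2).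
have inner f f' : expR (\sum_i tnth (block_spikes (a * sigma) f) i *
      tnth (block_spikes (a * sigma) f') i / sigma ^+ 2) =
    \prod_(k < s) (if f' k == f k then e else 1).
  rewrite -mulr_suml inner_block_spikes mulr_suml expR_sum.
  apply: eq_bigr => k _; rewrite eq_sym; case: ifP => _.
    by rewrite exprMn mulfK// expf_neq0// gt_eqF.
  by rewrite mul0r expR0.
have sum1 f : \sum_(f' : {ffun 'I_s -> 'I_m})
      \prod_(k < s) (if f' k == f k then e else 1) =
    (e + m.-1%:R) ^+ s.
  rewrite -(bigA_distr_bigA (fun k j => if j == f k then e else 1)).
  rewrite -[X in _ = _ ^+ X](card_ord s) -prodr_const; apply: eq_bigr => k _.
  rewrite (bigD1 (f k))//= eqxx; congr (_ + _).
  under eq_bigr => j /negbTE -> do [].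
  by rewrite sumr_const cardC1 card_ord.
under eq_bigr do under eq_bigr do rewrite inner.
under eq_bigr do rewrite sum1.
rewrite sumr_const -[LHS]mulr_natl expr2 -mulrA; congr (_ * _).
rewrite card_ffun !card_ord natrX -exprMn; congr (_ ^+ _).
have -> : (m.-1%:R : R) = m%:R - 1 by rewrite -{2}(prednK m0) -natr1 addrK.
by field; rewrite pnatr_eq0 -lt0n.
Qed.

End block_prior.

(** * Numerical inequalities *)

Lemma bernoulli_inequality (R : realDomainType) (y : R) n : 0 <= y ->
  1 + y *+ n <= (1 + y) ^+ n.
Proof.
move=> y0; elim: n => [|n IH]; first by rewrite mulr0n addr0 expr0.
rewrite exprS mulrDl mul1r mulrS addrCA addrC lerD//.
by rewrite ler_peMr// (le_trans _ IH)// lerDl mulrn_wge0.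
Qed.

Lemma ln_ge_onem_inv (R : realType) (x : R) : 0 < x -> 1 - x^-1 <= ln x.
Proof.
move=> x0; rewrite -lerN2 opprB -lnV ?posrE//.
have := @le_ln1Dx R (x^-1 - 1); rewrite [1 + _]addrC subrK; apply.
by rewrite ltrBrDr addNr invr_gt0.
Qed.

(** With [D = n ln n], the bound [ln x >= 1 - 1 / x] gives at least [S ^ 2 D / (S ^ 2 + D)], which
    is at least half the smaller of [S ^ 2] and [D]; both dominate [V ^ 2]. Later this absorbs the
    term [V * rho] of the constrained risk. *)
Lemma signal_strength_ge (R : realType) (n S V : R) : 6 <= n -> 0 < V ->
  V ^+ 4 = n -> V <= S ->
  V ^+ 2 / 2 <= S ^+ 2 * ln (1 + n * ln n / S ^+ 2).
Proof.
move=> n6 V0 Vn VS; have n0 : 0 < n by exact: lt_le_trans n6.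
have S0 : 0 < S by exact: lt_le_trans VS.
have S20 : 0 < S ^+ 2 by rewrite exprn_gt0.
have V20 : 0 < V ^+ 2 by rewrite exprn_gt0.
have V2S2 : V ^+ 2 <= S ^+ 2 by rewrite ler_sqr ?nnegrE// ltW.
have l_ge : 1 / 2 <= ln n.
  apply: le_trans (ln_ge_onem_inv n0).
  suff : n^-1 <= 6^-1 by move=> ?; lra.
  by rewrite lef_pV2 ?posrE.
(* Here [n = V ^ 2 * V ^ 2] with [V ^ 2 >= 2], and [ln n >= 1 / 2]. *)
have V2n : V ^+ 2 <= n * ln n.
  have V2_ge2 : 2 <= V ^+ 2.
    have : 2 ^+ 2 <= (V ^+ 2) ^+ 2.
      by rewrite -exprM Vn -natrX; apply: le_trans n6; rewrite ler_nat.
    by rewrite ler_sqr// nnegrE ltW.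
  apply: (@le_trans _ _ (n * (1 / 2))); last by rewrite ler_pM2l.
  rewrite -Vn (exprM _ 2 2) (expr2 (V ^+ 2)) -mulrA ler_peMr ?(ltW V20)//; lra.
set D := n * ln n in V2n *.
have D0 : 0 < D by exact: lt_le_trans V2n.
have x1 : 0 < 1 + D / S ^+ 2 by rewrite addr_gt0// divr_gt0.
apply: (@le_trans _ _ (S ^+ 2 * (1 - (1 + D / S ^+ 2)^-1))); last first.
  by rewrite ler_pM2l// ln_ge_onem_inv.
have -> : S ^+ 2 * (1 - (1 + D / S ^+ 2)^-1) = S ^+ 2 * D / (S ^+ 2 + D).
  by field; rewrite !gt_eqF// addr_gt0.
rewrite ler_pdivlMr ?addr_gt0// mulrAC ler_pdivrMr// mulrDr.
have h1 : V ^+ 2 * S ^+ 2 <= S ^+ 2 * D by rewrite mulrC ler_pM2l.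
have h2 : V ^+ 2 * D <= S ^+ 2 * D by rewrite ler_pM2r.
by rewrite mulr_natr mulr2n lerD.
Qed.

(** By [1 + y <= e ^ y] the left side is at most [e] to the power [d ln d / (8 s m)] with
    [m = d %/ s]. Since [s m >= d / 2], the divisor 8 brings the exponent down to [ln d / 4]. *)
Lemma block_chi2_le (R : realType) (d s : nat) : (0 < s <= d)%N -> (1 < d)%N ->
  (1 + (expR (ln (1 + d%:R * ln d%:R / s%:R ^+ 2 / 8)) - 1) / (d %/ s)%:R) ^+ s
    <= (d%:R : R) `^ (1 / 4).
Proof.
move=> /andP[s0 sd] d1; set l := ln d%:R; set m := (d %/ s)%N.
have m0 : (0 < m)%N by rewrite divn_gt0.
have d0 : (0 : R) < d%:R by rewrite ltr0n (leq_trans _ sd).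
have sR : (0 : R) < s%:R by rewrite ltr0n.
have mR : (0 : R) < m%:R by rewrite ltr0n.
have l0 : 0 <= l by rewrite ln_ge0// ler1n ltnW.
have x0 : 0 <= d%:R * l / s%:R ^+ 2 / 8.
  by rewrite !divr_ge0 ?mulr_ge0 ?exprn_ge0// ltW.
rewrite lnK ?posrE ?ltr_pwDl// addrAC subrr add0r.
apply: (@le_trans _ _ (expR (d%:R * l / s%:R ^+ 2 / 8 / m%:R) ^+ s)).
  rewrite lerXn2r ?nnegrE ?expR_ge0 ?expR_ge1Dx//.
  by rewrite addr_ge0// divr_ge0// ltW.
(* Rounding down loses at most a factor 2: [d < (m + 1) s <= 2 m s], as [m >= 1]. *)
have d_le : d%:R <= 2 * (s%:R * m%:R) :> R.
  rewrite -!natrM ler_nat; apply: (leq_trans (ltnW (ltn_ceil d s0))).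
  by rewrite -/m mulnC mulnCA leq_pmul2l// mul2n -addnn -addn1 leq_add2l.
rewrite -expRM_natr /powR gt_eqF// ler_expR.
rewrite (_ : _ * s%:R = d%:R * l / (8 * (s%:R * m%:R))); last first.
  by field; rewrite !gt_eqF.
rewrite ler_pdivrMr ?mulr_gt0//.
apply: (@le_trans _ _ (2 * (s%:R * m%:R) * l)); first by rewrite ler_wpM2r.
by rewrite -/l le_eqVlt; apply/orP; left; apply/eqP; field.
Qed.

(** * Choice of the constants and the contradiction *)

Theorem theorem2 (R : realType) :
  exists C0 C1 : R, 0 < C0 /\ 0 < C1 /\
  forall (d : nat) (sigma : R), (6 <= d)%N -> 0 < sigma ->
  forall (disp : measure_display) (Omega : measurableType disp)
    (P : probability Omega R) (xi : 'I_d -> {RV P >-> R}),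
  iid_standard_normal xi ->
  forall T : d.-tuple R -> R, measurable_fun [set: d.-tuple R] T ->
  (exists s : nat,
     [/\ (1 <= s <= d)%N,
         (d%:R : R) `^ (1 / 4) <= s%:R
       & (max_risk xi sigma T (sparse s) <=
          (C0 * sigma ^+ 2 * s%:R ^+ 2
             * ln (1 + d%:R * ln d%:R / s%:R ^+ 2))%:E)%E]) ->
  ((C1 * sigma ^+ 2 * d%:R `^ (1 / 4))%:E <=
     max_risk xi sigma T (sparse 1))%E.
Proof.
(* With [K] the squared value of [L] on the prior, the constants make the risk on [s]-sparse means
   and [V] times the risk at 0 at most [K / 16] each, against the lower bound [3 K / 16]. *)
exists (1 / 128), (1 / 256); split; first by rewrite divr_gt0.
split; first by rewrite divr_gt0.
move=> d sigma d6 sigma0 disp Omega P xi xi_iid T mT [s [/andP[s0 sd] Vs risk_s]].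
rewrite leNgt; apply/negP => risk_1.
set V : R := d%:R `^ (1 / 4) in Vs risk_1.
set x : R := d%:R * ln d%:R / s%:R ^+ 2 in risk_s.
have dR : (0 : R) < d%:R by rewrite ltr0n (leq_trans _ d6).
have sR : (0 : R) < s%:R by rewrite ltr0n.
have V0 : 0 < V by exact: powR_gt0.
have x0 : 0 < x.
  rewrite divr_gt0 ?exprn_gt0// mulr_gt0// ln_gt0// ltr1n.
  exact: leq_trans d6.
have V4 : V ^+ 4 = d%:R.
  by rewrite -powR_mulrn ?ltW// -powRrM mul1r mulVf// powRr1// ltW.
have strength : V ^+ 2 / 2 <= s%:R ^+ 2 * ln (1 + x).
  by apply: signal_strength_ge => //; rewrite ler_nat.
pose Y := ln (1 + x / 8).
have x8 : 0 < x / 8 by exact: divr_gt0.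
have x81 : 0 < 1 + x / 8 by exact: addr_gt0.
(* Bernoulli: [(1 + x / 8) ^ 8 >= 1 + x], so dividing by 8 inside the logarithm costs at most a
   factor 8. *)
have lnY : ln (1 + x) <= 8 * Y.
  rewrite /Y mulr_natl -lnXn//.
  rewrite ler_ln ?posrE ?(exprn_gt0, addr_gt0)//.
  apply: le_trans (bernoulli_inequality _ _); last exact: ltW.
  by rewrite -[x / 8 *+ 8]mulr_natr mulfVK.
have Y0 : 0 < Y by rewrite ln_gt0// ltrDl.
pose a := Num.sqrt Y.
have a0 : 0 < a by rewrite sqrtr_gt0.
have a2 : a ^+ 2 = Y by rewrite sqr_sqrtr// ltW.
have smd : (s * (d %/ s) <= d)%N by rewrite mulnC leq_divM.
have m0 : (0 < d %/ s)%N by rewrite divn_gt0.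
have [h h_inj] := ord_prod_embedding smd.
have F0 : (0 < #|{ffun 'I_s -> 'I_(d %/ s)}|)%N.
  by rewrite card_ffun !card_ord expn_gt0 m0.
have M0 : 0 < a * sigma *+ s by rewrite pmulrn_lgt0// mulr_gt0.
have risk_le k theta c : (max_risk xi sigma T (sparse k) <= c)%E ->
    sparse k theta -> (quadratic_risk xi sigma T theta <= c)%E.
  by move=> kc ktheta; apply: le_trans kc; apply: ereal_sup_ubound; exists theta.
have := constrained_risk xi_iid sigma0 mT M0 V0 F0
  (linear_functional_block_spikes h (a * sigma))
  (fun f => risk_le _ _ _ risk_s (sparse_block_spikes h (a * sigma) f)).
move=> /(_ (1 / 256 * sigma ^+ 2 * V)).
rewrite chi2_block_spikes// a2 => /(_ _ _)/wrap[].
(* The zero mean is 1-sparse, so the negated conclusion bounds its risk. *)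
- apply: risk_le (ltW risk_1) _; rewrite /sparse/= /l0_norm eq_card0// => i.
  by rewrite !inE tnth_mktuple eqxx.
- rewrite ler_pM2l ?exprn_gt0 ?ltr0n//; apply: block_chi2_le; rewrite ?s0//.
  exact: leq_trans d6.
pose K := sigma ^+ 2 * (s%:R ^+ 2 * Y).
have K0 : 0 < K by rewrite !mulr_gt0// exprn_gt0.
have sigma20 : 0 < sigma ^+ 2 by rewrite exprn_gt0.
have -> : (a * sigma *+ s) ^+ 2 = K.
  by rewrite -mulr_natr !exprMn a2 /K; ring.
have rK : 1 / 128 * sigma ^+ 2 * s%:R ^+ 2 * ln (1 + x) <= K / 16.
  rewrite (_ : K / 16 = 1 / 128 * sigma ^+ 2 * s%:R ^+ 2 * (8 * Y)).
    by apply: ler_wpM2l lnY; rewrite !mulr_ge0// ltW// exprn_gt0.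
  by rewrite /K; field.
have VK : V * (1 / 256 * sigma ^+ 2 * V) <= K / 16.
  have VY : V ^+ 2 <= 16 * (s%:R ^+ 2 * Y).
    have : s%:R ^+ 2 * ln (1 + x) <= s%:R ^+ 2 * (8 * Y).
      by rewrite ler_pM2l ?exprn_gt0.
    move=> /(le_trans strength); rewrite mulrCA; move: (s%:R ^+ 2 * Y) => q; lra.
  rewrite (_ : V * _ = sigma ^+ 2 / 256 * V ^+ 2); last by field.
  rewrite (_ : K / 16 = sigma ^+ 2 / 256 * (16 * (s%:R ^+ 2 * Y))).
    by rewrite ler_wpM2l// divr_ge0// ltW.
  by rewrite /K; field.
move=> /le_trans/(_ (lerD rK VK)); rewrite leNgt => /negP; apply.
by move: K0; move: (K) => k; lra.
Qed.
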